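(* For every $n\ge 2$, the presentation $$\left\langle s,t \mid s^n,\ [s,s^{t^i}],\ i\ge 1\right\rangle$$ is a minimal presentation of $\mathbb{Z}_n\wr\mathbb{Z}$.
   Context: $\mathbb{Z}_n=\mathbb{Z}/n\mathbb{Z}$, and $\mathbb{Z}_n\wr\mathbb{Z}$ is the restricted wreath product $\left(\bigoplus_{\mathbb{Z}}\mathbb{Z}_n\right)\rtimes\mathbb{Z}$ with $\mathbb{Z}$ acting by shifting coordinates. Notation: $x^y=y^{-1}xy$ and $[x,y]$ is the commutator of $x$ and $y$. For a subset $A$ of a group, $\langle\langle A\rangle\rangle$ denotes the normal subgroup generated by $A$. A presentation $\langle X\mid R\rangle$ is called minimal if for every $r\in R$ one has $r\notin\langle\langle R\setminus\{r\}\rangle\rangle$ (normal closure taken in the free group on $X$). *)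

(* Defs.v *)
From HB Require Import structures.
From mathcomp Require Import all_boot all_order all_algebra.
From mathcomp Require Import finmap monalg.
From mathcomp Require Import boolp classical_sets.

Set Implicit Arguments.
Unset Strict Implicit.
Unset Printing Implicit Defensive.

Local Open Scope classical_set_scope.
Local Open Scope group_scope.

(* The free group on X, realized as the set of reduced words: the letter      *)
(* (x, b) stands for the generator x if b = false, for x^-1 if b = true.      *)
Section FreeGroup.
Context (X : choiceType).

Local Notation letter := (X * bool)%type.

Implicit Types (a b : letter) (u v w : seq letter).

Definition linv a : letter := (a.1, ~~ a.2).

Definition reduced w := sorted (fun a b => b != linv a) w.

Definition cons_word a w :=
  if w is b :: w' then if b == linv a then w' else a :: w else [:: a].

Definition reduce w := foldr cons_word [::] w.

Lemma linvK : involutive linv.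
Proof. by case=> x b; rewrite /linv /= negbK. Qed.

Lemma cons_word_reduced a w : reduced w -> reduced (cons_word a w).
Proof.
case: w => [|b w] //= bw; case: ifPn => [_|ba]; first exact: path_sorted bw.
by rewrite /reduced /= ba.
Qed.

Lemma reduce_reduced w : reduced (reduce w).
Proof. by elim: w => //= a w IH; apply: cons_word_reduced. Qed.

Lemma reduce_id w : reduced w -> reduce w = w.
Proof.
elim: w => //= a w IH aw; rewrite (IH (path_sorted aw)).
by case: w aw {IH} => //= b w /andP[/negPf -> _].
Qed.

Lemma cons_wordK a w : reduced w -> cons_word a (cons_word (linv a) w) = w.
Proof.
case: w => [|b w] /=; first by rewrite eqxx.
rewrite linvK; case: eqVneq => [-> |_ _] /=; last by rewrite eqxx.
by case: w => [|c w] //= /andP[/negPf ->].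
Qed.

Lemma reduce_cons_word a w v :
  reduced w -> reduce (cons_word a w ++ v) = cons_word a (reduce (w ++ v)).
Proof.
case: w => [|b w] //= bw; case: ifPn => [/eqP ->|_] //=.
by rewrite cons_wordK ?reduce_reduced.
Qed.

Lemma reduce_catl u v : reduce (reduce u ++ v) = reduce (u ++ v).
Proof.
elim: u => //= a u IH.
by rewrite reduce_cons_word ?IH // reduce_reduced.
Qed.

Lemma reduce_catr u v : reduce (u ++ reduce v) = reduce (u ++ v).
Proof.
rewrite /reduce !foldr_cat -/(reduce v) -/(reduce (reduce v)).
by rewrite (reduce_id (reduce_reduced v)).
Qed.

Definition winv w := rev (map linv w).

Lemma reduced_winv w : reduced w -> reduced (winv w).
Proof.
rewrite /reduced /winv rev_sorted sorted_map => /sub_sorted; apply => a b /=.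
by rewrite linvK eq_sym.
Qed.

Lemma reduce_winvl w : reduce (winv w ++ w) = [::].
Proof.
elim: w => //= a w IH; rewrite /winv /= rev_cons cat_rcons.
rewrite -reduce_catr /= -{2}[a]linvK cons_wordK ?reduce_reduced //.
by rewrite reduce_catr.
Qed.

Lemma winvK : involutive winv.
Proof.
by move=> w; rewrite /winv map_rev revK -map_comp map_id_in // => a _ /=;
  exact: linvK.
Qed.

Record freegroup := FreeGroup { word : seq letter; _ : reduced word }.

HB.instance Definition _ := [isSub for word].
HB.instance Definition _ := [Choice of freegroup by <:].

Implicit Types f g h : freegroup.

Definition fg_mul f g := FreeGroup (reduce_reduced (word f ++ word g)).
Definition fg_one := @FreeGroup [::] isT.
Definition fg_inv f := FreeGroup (reduced_winv (valP f)).

Fact fg_mulA : associative fg_mul.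
Proof.
by move=> f g h; apply: val_inj; rewrite /= reduce_catl reduce_catr catA.
Qed.
Fact fg_mul1 : left_id fg_one fg_mul.
Proof. by move=> f; apply: val_inj; rewrite /= reduce_id // (valP f). Qed.
Fact fg_mulr1 : right_id fg_one fg_mul.
Proof. by move=> f; apply: val_inj; rewrite /= cats0 reduce_id // (valP f). Qed.
Fact fg_mulV : left_inverse fg_one fg_inv fg_mul.
Proof. by move=> f; apply: val_inj; rewrite /= reduce_winvl. Qed.
Fact fg_mulrV : right_inverse fg_one fg_inv fg_mul.
Proof.
by move=> f; apply: val_inj; rewrite /= -{1}[word f]winvK reduce_winvl.
Qed.

HB.instance Definition _ :=
  isGroup.Build freegroup fg_mulA fg_mul1 fg_mulr1 fg_mulV fg_mulrV.

Definition fg_gen (x : X) : freegroup := @FreeGroup [:: (x, false)] isT.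

End FreeGroup.

Section NormalClosure.
Context (G : groupType).
Implicit Types (A N : set G) (x y : G).

Definition normal_subgroup N :=
  [/\ N 1, forall x y, N x -> N y -> N (x * y), forall x, N x -> N x^-1
    & forall x y, N x -> N (x ^ y)].

Definition normal_closure A : set G := smallest normal_subgroup A.

Lemma normal_closure_normal A : normal_subgroup (normal_closure A).
Proof.
split=> [|x y Nx Ny|x Nx|x y Nx] N [nN AN]; case: (nN) => N1 NM NV NJ //.
- by apply: NM; [apply: Nx|apply: Ny].
- by apply: NV; apply: Nx.
- by apply: NJ; apply: Nx.
Qed.

End NormalClosure.

Section Presentation.
Local Open Scope quotient_scope.
Context (X : choiceType) (R : set (freegroup X)).
Notation N := (normal_closure R).
Implicit Types x y z : freegroup X.

Definition presented_rel : rel (freegroup X) := fun x y => `[< N (x^-1 * y) >].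

Fact presented_rel_equiv : equiv_class_of presented_rel.
Proof.
have [N1 NM NV NJ] := normal_closure_normal R.
have sym x y : presented_rel x y -> presented_rel y x.
  by move=> /asboolP/NV; rewrite invgM invgK => ?; apply/asboolP.
split=> [x|x y|y x z].
- by apply/asboolP; rewrite mulVg.
- by apply/idP/idP; apply: sym.
- move=> /asboolP Nxy /asboolP Nyz; apply/asboolP.
  by have := NM _ _ Nxy Nyz; rewrite mulgA mulgK.
Qed.

Canonical presented_rel_canonical := EquivRelPack presented_rel_equiv.

(* The group defined by the presentation < X | R >, i.e. the quotient of the  *)
(* free group on X by the normal closure of R.                                *)
Definition presented : Type := {eq_quot presented_rel}.

HB.instance Definition _ := Choice.on presented.
HB.instance Definition _ : EqQuotient _ presented_rel presented :=
  EqQuotient.on presented.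

Definition pr_mul (a b : presented) : presented :=
  \pi_presented (repr a * repr b).
Definition pr_inv (a : presented) : presented := \pi_presented (repr a)^-1.
Definition pr_one : presented := \pi_presented 1.

Lemma pr_eqP x y :
  reflect (\pi_presented x = \pi_presented y) (`[< N (x^-1 * y) >]).
Proof. exact: eqmodP. Qed.

Lemma pr_reprP x : N ((repr (\pi_presented x))^-1 * x).
Proof. by apply/asboolP; apply/pr_eqP; rewrite reprK. Qed.

Lemma pr_mulE x y :
  pr_mul (\pi_presented x) (\pi_presented y) = \pi_presented (x * y).
Proof.
have [N1 NM NV NJ] := normal_closure_normal R.
apply/pr_eqP/asboolP; set x' := repr _; set y' := repr _.
have -> : (x' * y')^-1 * (x * y) = (x'^-1 * x) ^ y' * (y'^-1 * y).
  by rewrite /conjg invgM !mulgA mulgK.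
by apply: NM; [apply: NJ|]; apply: pr_reprP.
Qed.

Lemma pr_invE x : pr_inv (\pi_presented x) = \pi_presented x^-1.
Proof.
have [N1 NM NV NJ] := normal_closure_normal R.
apply/pr_eqP/asboolP; rewrite invgK; set x' := repr _.
have -> : x' * x^-1 = ((x'^-1 * x)^-1) ^ x'^-1.
  by rewrite /conjg invgM !invgK !mulgA mulgK.
by apply: NJ; apply: NV; apply: pr_reprP.
Qed.

Lemma pr_ind (P : presented -> Prop) :
  (forall x, P (\pi_presented x)) -> forall a, P a.
Proof. by move=> piP a; rewrite -(reprK a); apply: piP. Qed.

Fact pr_mulA : associative pr_mul.
Proof.
by elim/pr_ind=> x; elim/pr_ind=> y; elim/pr_ind=> z; rewrite !pr_mulE mulgA.
Qed.
Fact pr_mul1 : left_id pr_one pr_mul.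
Proof. by elim/pr_ind=> x; rewrite pr_mulE mul1g. Qed.
Fact pr_mulr1 : right_id pr_one pr_mul.
Proof. by elim/pr_ind=> x; rewrite pr_mulE mulg1. Qed.
Fact pr_mulV : left_inverse pr_one pr_inv pr_mul.
Proof. by elim/pr_ind=> x; rewrite pr_invE pr_mulE mulVg. Qed.
Fact pr_mulrV : right_inverse pr_one pr_inv pr_mul.
Proof. by elim/pr_ind=> x; rewrite pr_invE pr_mulE mulgV. Qed.

HB.instance Definition _ :=
  isGroup.Build presented pr_mulA pr_mul1 pr_mulr1 pr_mulV pr_mulrV.

End Presentation.

Definition isomorphic (G H : groupType) :=
  exists f : {multiplicative G -> H}, bijective f.

Definition presentation_of (X : choiceType) (R : set (freegroup X))
  (G : groupType) := isomorphic (presented R) G.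

Definition minimal_presentation (X : choiceType) (R : set (freegroup X)) :=
  forall r, R r -> ~ normal_closure (R `\ r) r.

(* The restricted wreath product of the additive group A with Z, where m acts *)
(* by f |-> f (_ - m); {malg A[int]} is only used as the additive group of    *)
(* finitely supported maps int -> A, i.e. the direct sum of copies of A.      *)
Section Wreath.
Local Open Scope ring_scope.
Context (A : zmodType).
Implicit Types (f g : {malg A[int]}) (m k : int).

Definition shift m f : {malg A[int]} :=
  [malg k in [fset (j + m)%R | j in msupp f]%fset => f@_(k - m)].

Lemma shiftE m f k : (shift m f)@_k = f@_(k - m).
Proof.
rewrite [LHS]fsfunE; case: imfsetP => // H; rewrite /mcoeff.
case: finsuppP => // kf; case: H.
by exists (k - m) => //=; rewrite GRing.subrK.
Qed.

Lemma shiftD m f g : shift m (f + g) = shift m f + shift m g.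
Proof. by apply/malgP => k; rewrite mcoeffD !shiftE mcoeffD. Qed.

Lemma shift_shift m k f : shift m (shift k f) = shift (m + k) f.
Proof.
by apply/malgP => j; rewrite !shiftE GRing.opprD GRing.addrA.
Qed.

Lemma shift0 f : shift 0 f = f.
Proof. by apply/malgP => k; rewrite shiftE GRing.subr0. Qed.

Lemma shiftm0 m : shift m 0 = 0.
Proof. by apply/malgP => k; rewrite shiftE !mcoeff0. Qed.

Definition wreath_int : Type := ({malg A[int]} * int)%type.

HB.instance Definition _ := Choice.on wreath_int.

Implicit Types x y : wreath_int.

Definition wr_mul x y : wreath_int := (x.1 + shift x.2 y.1, x.2 + y.2).
Definition wr_one : wreath_int := (0, 0).
Definition wr_inv x : wreath_int := (shift (- x.2) (- x.1), - x.2).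

Fact wr_mulA : associative wr_mul.
Proof.
move=> [f m] [g k] [h l]; rewrite /wr_mul /=.
by rewrite shiftD shift_shift !GRing.addrA.
Qed.
Fact wr_mul1 : left_id wr_one wr_mul.
Proof. by case=> f m; rewrite /wr_mul /= shift0 !GRing.add0r. Qed.
Fact wr_mulr1 : right_id wr_one wr_mul.
Proof. by case=> f m; rewrite /wr_mul /= shiftm0 !GRing.addr0. Qed.
Fact wr_mulV : left_inverse wr_one wr_inv wr_mul.
Proof.
case=> f m; rewrite /wr_mul /= -shiftD.
by rewrite !GRing.addNr shiftm0.
Qed.
Fact wr_mulrV : right_inverse wr_one wr_inv wr_mul.
Proof.
case=> f m; rewrite /wr_mul /= shift_shift.
by rewrite GRing.addrN shift0 GRing.addrN.
Qed.

HB.instance Definition _ :=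
  isGroup.Build wreath_int wr_mulA wr_mul1 wr_mulr1 wr_mulV wr_mulrV.

End Wreath.

Definition gen_s : freegroup 'I_2 := fg_gen ord0.
Definition gen_t : freegroup 'I_2 := fg_gen ord_max.

Definition lamplighter_rels (n : nat) : set (freegroup 'I_2) :=
  [set gen_s ^+ n] `|`
  [set [~ gen_s, gen_s ^ (gen_t ^+ i)] | i in [set i | (1 <= i)%N]].

(* Main.v *)
(** Modulo the relators every element of the free group is a product of
    conjugates [s^(t^k)] times a power of [t]. These conjugates commute and have
    exponent [n], so such a product is determined by its exponent sum in [t] and
    by the number, modulo [n], of factors with each index [k]; both are read off
    its image in the wreath product.

    Minimality: [s^n] acts nontrivially on the integers when [s] acts as the
    successor and [t] trivially, while all commutators die. For the [i]-th
    commutator, let [t] shift functions [f : Z -> Z_n] and let [s] send [(f, c)]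
    to [(f + delta_0, c + f i)], an infinite Heisenberg action: [s^(t^j)] sends
    [(f, c)] to [(f + delta_j, c + f (i + j))], so the two orders of composing
    it with [s] differ by [delta_j i] in the second component, which vanishes
    exactly when [j <> i]. *)

From HB Require Import structures.
Require Import Defs.
From mathcomp Require Import all_boot all_order all_algebra.
From mathcomp Require Import finmap monalg boolp classical_sets functions.
From mathcomp Require Import zify.

Set Implicit Arguments.
Unset Strict Implicit.
Unset Printing Implicit Defensive.

Import Order.TTheory GRing.Theory Num.Theory.
Local Open Scope classical_set_scope.
Local Open Scope group_scope.

(** * Induction on reduced words, and actions of the free group *)

Section FreeGroupInduction.
Context (X : choiceType).

(** The tail of a reduced word is reduced, and putting its head back causes no cancellation. *)
Lemma freegroup_ind (P : freegroup X -> Prop) :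
  P 1 -> (forall i x, P x -> P (fg_gen i * x)) ->
  (forall i x, P x -> P ((fg_gen i)^-1 * x)) -> forall x, P x.
Proof.
move=> P1 PM PV [w rw]; elim: w rw => [|[i b] w IH] rw.
  by have -> : FreeGroup rw = 1 by apply: val_inj.
have rw' : reduced w := path_sorted rw.
have redE c : reduce ((i, c) :: w) = cons_word (i, c) w.
  by rewrite /= reduce_id.
have consE : cons_word (i, b) w = (i, b) :: w.
  by case: w rw {IH rw' redE} => //= c w /andP[/negPf -> _].
case: b rw consE => rw consE.
- have -> : FreeGroup rw = (fg_gen i)^-1 * FreeGroup rw'.
    by apply: val_inj; rewrite /= -[LHS]consE -redE.
  exact: PV.
- have -> : FreeGroup rw = fg_gen i * FreeGroup rw'.
    by apply: val_inj; rewrite /= -[LHS]consE -redE.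
  exact: PM.
Qed.

End FreeGroupInduction.

Section FreeGroupAction.
Context (X : choiceType) (T : Type) (e e' : X -> T -> T).
Hypotheses (eK : forall i, cancel (e i) (e' i)).
Hypotheses (e'K : forall i, cancel (e' i) (e i)).
Implicit Types (x y : freegroup X) (p : T).

Definition act_letter (a : X * bool) := if a.2 then e' a.1 else e a.1.
(** Under [eK] and [e'K] this is the homomorphism from the free group to the permutations of [T]
    extending [e]. *)
Definition act x p := foldr act_letter p (word x).

Lemma act_reduce w p : foldr act_letter p (reduce w) = foldr act_letter p w.
Proof.
have cons a v : foldr act_letter p (cons_word a v)
    = act_letter a (foldr act_letter p v).
  case: v => [|b v] //=; case: eqP => [->|//].
  by case: a => i [] /=; rewrite /act_letter /= ?eK ?e'K.
by elim: w => //= a w IH; rewrite cons IH.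
Qed.

Lemma act1 p : act 1 p = p. Proof. by []. Qed.

Lemma act_gen i p : act (fg_gen i) p = e i p. Proof. by []. Qed.

Lemma actM x y p : act (x * y) p = act x (act y p).
Proof. by rewrite /act act_reduce foldr_cat. Qed.

Lemma actVK x p : act x^-1 (act x p) = p.
Proof. by rewrite -actM mulVg. Qed.

Lemma actX x m p : act (x ^+ m) p = iter m (act x) p.
Proof. by elim: m => //= m IH; rewrite expgS actM IH. Qed.

Lemma act_commgP x y :
  (forall p, act [~ x, y] p = p) <->
  (forall p, act x (act y p) = act y (act x p)).
Proof.
split=> h p; first by rewrite -!actM [x * y]commgC [LHS]actM h.
by rewrite commgEl conjgE !actM h !actVK.
Qed.

Lemma normal_closure_act (A : set (freegroup X)) :
  (forall r, A r -> forall p, act r p = p) ->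
  forall x, normal_closure A x -> forall p, act x p = p.
Proof.
(* The elements that act trivially form a normal subgroup containing [A]. *)
move=> hA x hx; apply: (hx [set y | forall p, act y p = p]).
split; last by move=> r /hA.
split=> [//|y z hy hz p|y hy p|y z hy p] /=.
- by rewrite actM hz hy.
- by rewrite -{1}(hy p) actVK.
- by rewrite conjgE !actM hy actVK.
Qed.

End FreeGroupAction.

(** * Integer powers *)

Section IntegerPowers.
Context (G : groupType).
Implicit Types (t x : G) (a b : int).

Definition expgz t a := if a is Negz m then t ^- m.+1 else t ^+ `|a|%N.

Lemma expgz1D t a : expgz t (a + 1)%R = expgz t a * t.
Proof.
case: a => [m|[|m]].
- have -> : (Posz m + 1)%R = Posz m.+1 by lia.
  by rewrite /= expgSr.
- by rewrite /= expg1 mulVg.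
- have -> : (Negz m.+1 + 1)%R = Negz m by lia.
  by rewrite /= [t ^+ m.+2]expgS invgM mulgVK.
Qed.

Lemma expgzD t a b : expgz t (a + b)%R = expgz t a * expgz t b.
Proof.
elim/int_rec: b => [|m IH|m IH]; first by rewrite addr0 mulg1.
- have -> : (m.+1%:Z = m%:Z + 1)%R by lia.
  by rewrite addrA !expgz1D IH mulgA.
(* Multiplying by [t] on the right turns [- m.+1] into [- m], the case of the induction
   hypothesis. *)
- apply: (@mulIg _ t); rewrite -mulgA -!expgz1D.
  have -> : (- m.+1%:Z + 1 = - m%:Z)%R by lia.
  by rewrite -IH; congr expgz; lia.
Qed.

End IntegerPowers.

Lemma gmulfXz (G H : groupType) (f : UMagmaMorphism.type G H) (t : G) a :
  f (expgz t a) = expgz (f t) a.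
Proof. by case: a => m /=; rewrite ?gmulfV gmulfXn. Qed.

Lemma ord2_ind (P : 'I_2 -> Prop) : P ord0 -> P ord_max -> forall i, P i.
Proof.
move=> P0 P1 [[|[|//]] lt_i2].
- by rewrite (_ : Ordinal _ = ord0) //; apply: val_inj.
- by rewrite (_ : Ordinal _ = ord_max) //; apply: val_inj.
Qed.

(** * Normal forms: conjugates of [s] times a power of [t] *)

Section NormalForm.
Context (G : groupType) (s t : G).
Implicit Types (l : seq int) (a m : int).

Definition sconj a : G := s ^ expgz t a.
Definition nform l m : G := (\prod_(k <- l) sconj k) * expgz t m.

Lemma sconjJ a m : sconj a ^ expgz t m = sconj (a + m)%R.
Proof. by rewrite /sconj expgzD conjgM. Qed.

(** Moving [t^a] to the right past the product conjugates each factor by [t^(-a)], which subtracts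
    [a] from its index. *)
Lemma mul_expgz_nform a l m :
  expgz t a * nform l m = nform [seq (k - a)%R | k <- l] (a + m)%R.
Proof.
have VE : (expgz t a)^-1 = expgz t (- a)%R.
  by apply: mulg1_eq; rewrite -expgzD subrr.
rewrite /nform big_map expgzD !mulgA; congr (_ * _).
rewrite conjgCV VE conjg_prod; congr (_ * _).
by apply: eq_bigr => k _; rewrite sconjJ.
Qed.

Lemma mul_expg_nform j l m : s ^+ j * nform l m = nform (nseq j 0%R ++ l) m.
Proof.
elim: j => [|j IH]; first by rewrite mul1g.
by rewrite expgS -mulgA IH /nform /= big_cons /sconj conjg1 mulgA.
Qed.

Hypothesis comm_s : forall i, 1 <= i -> commute s (s ^ (t ^+ i)).

Lemma commute_sconj a b : commute (sconj a) (sconj b).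
Proof.
wlog le_ab : a b / (a <= b)%R.
  by move=> hw; case/orP: (le_total a b) => /hw // /commute_sym.
have [j bE] : exists j : nat, b = (j%:Z + a)%R by exists `|b - a|%N; lia.
(* Undoing the conjugation by [t^a] leaves [s] and [s^(t^j)]: [comm_s] covers [j >= 1], and [j = 0]
   is trivial. *)
rewrite bE -[a in sconj a]add0r -!sconjJ -/(commute _ _) /commute -!conjMg.
congr (_ ^ _); rewrite /sconj conjg1 /=.
by case: j {bE} => [|j]; [rewrite conjg1|apply: comm_s].
Qed.

Lemma prod_sconj_count a l :
  \prod_(k <- l) sconj k =
  sconj a ^+ count_mem a l * \prod_(k <- l | k != a) sconj k.
Proof.
elim: l => [|b l IH]; first by rewrite !big_nil mulg1.
rewrite !big_cons IH /=; case: eqVneq => [->|_] /=.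
  by rewrite add1n expgS mulgA.
rewrite add0n mulgA [RHS]mulgA; congr (_ * _).
by apply: commuteX; apply: commute_sconj.
Qed.

(** All factors with the index of the head gather into a power whose exponent is divisible by [n],
    hence trivial. Removing them shortens the list and keeps the other counts. *)
Lemma prod_sconj_eq1 n l : s ^+ n = 1 ->
  (forall a, n %| count_mem a l)%N -> \prod_(k <- l) sconj k = 1.
Proof.
move=> sn1; have [p] := ubnP (size l); elim: p => // p IH in l *.
case: l => [|a l] lt_lp nl; first by rewrite big_nil.
rewrite (prod_sconj_count a) -big_filter IH; first 1 last.
- rewrite (leq_trans _ (lt_lp : size l < p)) // ltnS /= eqxx /= size_filter.
  exact: count_size.
- move=> b; rewrite count_filter; have [->|ne_ba] := eqVneq b a.
    by rewrite (eq_count (a2 := pred0)) ?count_pred0 // => x /=; case: eqP.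
  rewrite (eq_count (a2 := pred1 b)) // => x /=.
  by have [->|//] := eqVneq x b; rewrite ne_ba.
- have /dvdnP[q ->] := nl a.
  by rewrite mulnC expgnA -conjXg sn1 conj1g expg1n mulg1.
Qed.

End NormalForm.

Lemma gmulf_nform (G H : groupType) (f : UMagmaMorphism.type G H) (s t : G) l m :
  f (nform s t l m) = nform (f s) (f t) l m.
Proof.
rewrite /nform gmulfM gmulf_prod gmulfXz; congr (_ * _).
by apply: eq_bigr => k _; rewrite /sconj gmulfJ gmulfXz.
Qed.

(** * The Heisenberg action *)

Section HeisenbergAction.
Context (A : nzRingType) (i : nat).
Hypothesis i_gt0 : 0 < i.
Local Open Scope ring_scope.

Implicit Type p : (int -> A) * A.

Definition heis_s p := (fun k => p.1 k + (k == 0)%:R, p.2 + p.1 i%:Z).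
Definition heis_s' p := (fun k => p.1 k - (k == 0)%:R, p.2 - p.1 i%:Z).
Definition heis_t j p := (fun k => p.1 (k + j), p.2).

Definition heis_e (g : 'I_2) := if g == ord0 then heis_s else heis_t 1.
Definition heis_e' (g : 'I_2) := if g == ord0 then heis_s' else heis_t (- 1).

(** Adding [delta_0] leaves the value at [i] unchanged. Hence [heis_s'] inverts [heis_s], and [s^m]
    adds [m] times that value. *)
Let i_neq0 : (i%:Z == 0) = false. Proof. by case: i i_gt0. Qed.

Lemma heis_eK g : cancel (heis_e g) (heis_e' g).
Proof.
rewrite /heis_e /heis_e'; case: eqP => _ [f c]; congr pair => /=.
- by apply/funext => k; rewrite addrK.
- by rewrite i_neq0 addr0 addrK.
- by apply/funext => k; rewrite subrK.
Qed.

Lemma heis_e'K g : cancel (heis_e' g) (heis_e g).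
Proof.
rewrite /heis_e /heis_e'; case: eqP => _ [f c]; congr pair => /=.
- by apply/funext => k; rewrite subrK.
- by rewrite i_neq0 subr0 subrK.
- by apply/funext => k; rewrite addrK.
Qed.

Local Notation hact := (act heis_e heis_e').

Lemma heis_act_sX m p : hact (gen_s ^+ m)%g p =
  (fun k => p.1 k + (k == 0)%:R *+ m, p.2 + p.1 i%:Z *+ m).
Proof.
rewrite (actX heis_eK heis_e'K); elim: m => [|m IH] /=.
  by case: p => f c; congr pair; rewrite ?addr0 //; apply/funext => k; rewrite addr0.
rewrite IH act_gen /heis_e eqxx /heis_s /=; congr pair.
  by apply/funext => k; rewrite -addrA -mulrSr.
by rewrite i_neq0 mul0rn addr0 -addrA -mulrSr.
Qed.

Lemma heis_act_tX m p : hact (gen_t ^+ m)%g p = heis_t m%:Z p.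
Proof.
rewrite (actX heis_eK heis_e'K); elim: m => [|m IH] /=.
  by case: p => f c; congr pair; apply/funext => k; rewrite addr0.
rewrite IH act_gen /heis_e /= /heis_t /=; congr pair.
by apply/funext => k; congr (p.1 _); lia.
Qed.

Lemma heis_act_sJ j p : hact (gen_s ^ (gen_t ^+ j))%g p =
  (fun k => p.1 k + (k == j%:Z)%:R, p.2 + p.1 (i + j)%:Z).
Proof.
have hM := actM heis_eK heis_e'K.
(* Applying the injective action of [t^j] to both sides clears the inverse, as
   [t^j * s^(t^j) = s * t^j]. *)
apply: (can_inj (fun p => actVK heis_eK heis_e'K (gen_t ^+ j)%g p)).
rewrite -hM /conjg mulVKg hM !heis_act_tX act_gen /heis_e eqxx /heis_s /heis_t /=.
congr pair; apply/funext => k; congr (_ + _%:R)%R.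
by congr nat_of_bool; apply/eqP/eqP; lia.
Qed.

End HeisenbergAction.

(** * Minimality: no relator is redundant *)

Lemma sX_not_redundant n : 0 < n ->
  ~ normal_closure (lamplighter_rels n `\ gen_s ^+ n) (gen_s ^+ n).
Proof.
move=> n_gt0 hN.
pose e (g : 'I_2) (z : int) := if g == ord0 then (z + 1)%R else z.
pose e' (g : 'I_2) (z : int) := if g == ord0 then (z - 1)%R else z.
have eK g : cancel (e g) (e' g) by move=> z; rewrite /e /e'; case: eqP; lia.
have e'K g : cancel (e' g) (e g) by move=> z; rewrite /e /e'; case: eqP; lia.
have hM := actM eK e'K.
have tX m z : act e e' (gen_t ^+ m) z = z.
  by rewrite (actX eK e'K); elim: m => //= m ->.
have tVX m z : act e e' (gen_t ^- m) z = z.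
  by rewrite -{1}(tX m z) (actVK eK e'K).
have := normal_closure_act eK e'K _ hN 0%R; rewrite (actX eK e'K).
have -> : iter n (act e e' gen_s) 0%R = Posz n.
  by elim: (n) => //= m ->; rewrite act_gen /e eqxx; lia.
move=> h; suff : Posz n = 0%R by lia.
apply: h => r [[->|[j _ <-]] ne_r z]; first by case: ne_r.
apply: (act_commgP eK e'K _ _).2 => {}z.
(* As [t] acts trivially, [s^(t^j)] acts as [s], which commutes with itself. *)
by rewrite /conjg !hM !(tX, tVX).
Qed.

Lemma commg_not_redundant n i : 1 < n -> 0 < i ->
  let r := [~ gen_s, gen_s ^ (gen_t ^+ i)] in
  ~ normal_closure (lamplighter_rels n `\ r) r.
Proof.
move=> n_gt1 i_gt0 r hN.
have eK := @heis_eK 'Z_n i i_gt0; have e'K := @heis_e'K 'Z_n i i_gt0.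
have sJ := @heis_act_sJ 'Z_n i i_gt0.
have sE (p : (int -> 'Z_n) * 'Z_n) :
  act (heis_e i) (heis_e' i) gen_s p = heis_s i p by [].
have hr : forall p : (int -> 'Z_n) * 'Z_n, act (heis_e i) (heis_e' i) r p = p.
  apply: (normal_closure_act eK e'K _ hN) => _ [[->|[j j_gt0 <-]] ne_r] [f c].
    rewrite heis_act_sX //=; congr pair.
      by apply/funext => k; rewrite -mulr_natr pchar_Zp ?mulr0 ?addr0.
    by rewrite -mulr_natr pchar_Zp ?mulr0 ?addr0.
  have ne_ji : j != i by apply/eqP => eji; apply: ne_r; rewrite /r -eji.
  apply: (act_commgP eK e'K _ _).2 => {f c} -[f c].
  (* In the second components the two orders differ only by the indicators of [i = j] and of
     [i + j = 0], both zero here. *)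
  rewrite !(sJ, sE) /heis_s /=; congr pair.
    by apply/funext => k; rewrite addrAC.
  have -> : (Posz i == j) = false by apply/negbTE; rewrite eq_sym.
  have -> : (Posz (i + j) == 0%R) = false by move: i_gt0 j_gt0 => /=; lia.
  by rewrite !addr0 addrAC.
(* For [j = i], starting from the zero function, these indicators are [1] and [0], which differ in
   ['Z_n]. *)
have /(congr1 snd) := (act_commgP eK e'K _ _).1 hr (fun=> 0%R, 0%R).
rewrite !(sJ, sE) /heis_s /= eqxx.
have -> : (Posz (i + i) == 0%R) = false by lia.
by rewrite !add0r => /eqP; rewrite oner_eq0.
Qed.

(** * The isomorphism with the wreath product *)

Section Projection.
Context (X : choiceType) (R : set (freegroup X)).

Definition pr_pi (x : freegroup X) : presented R := (\pi_(presented R) x)%qT.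

Lemma pr_piM : (pr_pi 1 = 1) * {morph pr_pi : x y / x * y}.
Proof. by split=> // x y; rewrite /pr_pi -pr_mulE. Qed.

HB.instance Definition _ :=
  isUMagmaMorphism.Build (freegroup X) (presented R) pr_pi pr_piM.

Lemma pr_pi_eq1 x : normal_closure R x -> pr_pi x = 1.
Proof.
by move=> Nx; apply/esym/pr_eqP/asboolP; rewrite invg1 mul1g.
Qed.

End Projection.
Arguments pr_pi {X} R x.

Section Wreath.
Context (n : nat).
Hypothesis n_gt1 : 1 < n.
Local Notation W := (wreath_int 'Z_n).
Local Notation P := (presented (lamplighter_rels n)).

Lemma wr_mulE (x y : W) : x * y = (x.1 + shift x.2 y.1, x.2 + y.2)%R :> W.
Proof. by []. Qed.

Lemma shiftU m (c : 'Z_n) k :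
  shift m << c *g k >>%R = << c *g (k + m)%R >>%R :> {malg 'Z_n[int]}.
Proof.
apply/malgP => j; rewrite shiftE !mcoeffU; congr (_ *+ _)%R.
by congr nat_of_bool; apply/eqP/eqP; lia.
Qed.

Definition wr_s : W := (<< 1 *g 0 >>%R, 0%R).
Definition wr_t : W := (0%R, 1%R).

Lemma wr_expgz_t m : expgz wr_t m = (0%R, m).
Proof.
have pos j : wr_t ^+ j = (0%R, Posz j).
  elim: j => // j IH; rewrite expgS IH wr_mulE /= shiftm0 addr0.
  by congr pair; lia.
case: m => j; rewrite /expgz pos //.
by congr pair; rewrite /= ?oppr0 ?shiftm0 //; lia.
Qed.

Lemma wr_base_expg f j : ((f, 0%R) : W) ^+ j = ((f *+ j)%R, 0%R).
Proof.
elim: j => // j IH.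
by rewrite expgS IH wr_mulE /= shift0 addr0 mulrS.
Qed.

(** The sign comes from [x ^ y] being [y^-1 * x * y]: the shift applied to the support [{0}] is that
    of [t^(-a)]. *)
Lemma wr_sconj a : sconj wr_s wr_t a = (<< 1 *g (- a)%R >>%R, 0%R).
Proof.
rewrite /sconj wr_expgz_t /conjg !wr_mulE /= oppr0 !shiftm0.
by rewrite addr0 !add0r addNr shiftU add0r.
Qed.

Lemma wr_nform l m :
  nform wr_s wr_t l m = ((\sum_(k <- l) << 1 *g (- k) >>)%R, m).
Proof.
have -> : nform wr_s wr_t l m =
    (((\sum_(k <- l) << 1 *g (- k) >>)%R, 0%R) : W) * ((0%R, m) : W).
  rewrite /nform wr_expgz_t; congr (_ * _).
  elim: l => [|k l IH]; first by rewrite !big_nil.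
  by rewrite !big_cons IH wr_sconj wr_mulE /= shift0 addr0.
by rewrite wr_mulE /= shift0 addr0 add0r.
Qed.

Lemma wr_comm_s i : commute wr_s (wr_s ^ (wr_t ^+ i)).
Proof.
rewrite -[wr_s ^ _]/(sconj wr_s wr_t (Posz i)) wr_sconj /commute !wr_mulE /=.
by rewrite !shift0 addrC.
Qed.

Lemma wr_s_expg : wr_s ^+ n = 1.
Proof. by rewrite wr_base_expg -monalgUMn pchar_Zp // monalgU0. Qed.

(** Through the left regular action, the image of a word in [W] is what it sends [1] to, so the
    results on actions apply. *)
Definition wr_e (g : 'I_2) : W -> W :=
  *%g (if g == ord0 then wr_s else wr_t).
Definition wr_e' (g : 'I_2) : W -> W :=
  *%g (if g == ord0 then wr_s else wr_t)^-1.

Lemma wr_eK g : cancel (wr_e g) (wr_e' g). Proof. exact: mulKg. Qed.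
Lemma wr_e'K g : cancel (wr_e' g) (wr_e g). Proof. exact: mulVKg. Qed.

Definition wr_eval (x : freegroup 'I_2) : W := act wr_e wr_e' x 1.

Lemma act_wr_eval x p : act wr_e wr_e' x p = wr_eval x * p.
Proof.
rewrite /wr_eval /act; elim: (word x) => [|[g b] w IH] /=; first by rewrite mul1g.
by rewrite IH; case: b; rewrite /act_letter /= [LHS]mulgA.
Qed.

Lemma wr_evalM : {morph wr_eval : x y / x * y}.
Proof.
by move=> x y; rewrite {1}/wr_eval (actM wr_eK wr_e'K) act_wr_eval.
Qed.


Lemma wr_eval_rel r : lamplighter_rels n r -> wr_eval r = 1.
Proof.
have ev1 : wr_eval 1 = 1 by [].
have evV x : wr_eval x^-1 = (wr_eval x)^-1.
  by apply/esym/mulg1_eq; rewrite -wr_evalM mulgV.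
have evX x m : wr_eval (x ^+ m) = wr_eval x ^+ m.
  by elim: m => // m IH; rewrite !expgS wr_evalM IH.
have evs : wr_eval gen_s = wr_s by exact: mulg1.
have evt : wr_eval gen_t = wr_t by exact: mulg1.
move=> [->|[i _ <-]]; first by rewrite evX evs wr_s_expg.
apply/eqP; rewrite !(commgEl, conjgE, wr_evalM, evV, evX, evs, evt) -conjgE.
exact/commgP/wr_comm_s.
Qed.

Lemma wr_eval_normal_closure x :
  normal_closure (lamplighter_rels n) x -> wr_eval x = 1.
Proof.
move=> Nx; apply: (normal_closure_act wr_eK wr_e'K _ Nx) => r /wr_eval_rel r1 p.
by rewrite act_wr_eval r1 mul1g.
Qed.

Definition wr_pres (a : P) : W := wr_eval (repr a).
Local Notation pi := (pr_pi (lamplighter_rels n)).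

(** The choice of [repr] does not matter: it differs from [x] by an element of the normal closure,
    which [wr_eval] kills. *)
Lemma wr_presE x : wr_pres (pi x) = wr_eval x.
Proof.
have /wr_eval_normal_closure := @pr_reprP _ (lamplighter_rels n) x.
rewrite wr_evalM => h; rewrite /wr_pres.
apply/eqP; rewrite -(inj_eq (@mulgI W (wr_eval (repr (pi x))^-1))) h.
by rewrite -wr_evalM mulVg.
Qed.

Lemma wr_presM : (wr_pres 1 = 1) * {morph wr_pres : x y / x * y}.
Proof.
split; first by rewrite -[1]/(pi 1) wr_presE.
elim/pr_ind=> x; elim/pr_ind=> y.
by rewrite -!/(pi _) -pr_piM !wr_presE wr_evalM.
Qed.

HB.instance Definition _ := isUMagmaMorphism.Build P W wr_pres wr_presM.

Let ps : P := pr_pi _ gen_s.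
Let pt : P := pr_pi _ gen_t.

Lemma ps_expg : ps ^+ n = 1.
Proof. by rewrite -gmulfXn; apply: pr_pi_eq1 => N [_]; apply; left. Qed.

Lemma ps_comm i : 1 <= i -> commute ps (ps ^ (pt ^+ i)).
Proof.
move=> i_gt0; apply/commgP/eqP; rewrite -gmulfXn -gmulfJ -gmulfR.
by apply: pr_pi_eq1 => N [_]; apply; right; exists i.
Qed.

Lemma pres_nform (a : P) : exists l m, a = nform ps pt l m.
Proof.
elim/pr_ind: a => x; rewrite -/(pi x); elim/freegroup_ind: x.
- by exists [::], 0%R; rewrite /nform big_nil mulg1.
- move=> g x [l [m xE]]; rewrite pr_piM xE; elim/ord2_ind: g.
    by exists (nseq 1 0%R ++ l), m; rewrite -mul_expg_nform.
  by exists [seq (k - 1)%R | k <- l], (1 + m)%R; rewrite -mul_expgz_nform.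
- move=> g x [l [m xE]]; rewrite pr_piM xE; elim/ord2_ind: g.
    (* The relator [s^n] gives [s^-1 = s^(n-1)], so no negative exponents of [s] are needed. *)
    exists (nseq n.-1 0%R ++ l), m; rewrite -mul_expg_nform.
    congr (_ * _); rewrite gmulfV; apply: mulg1_eq.
    by rewrite -expgS prednK ?ps_expg // ltnW.
  exists [seq (k - (- 1))%R | k <- l], (- 1 + m)%R; rewrite -mul_expgz_nform.
  by rewrite gmulfV.
Qed.

Lemma wr_pres_inj : injective wr_pres.
Proof.
apply: gmulf_inj => a; have [l [m ->]] := pres_nform a.
rewrite gmulf_nform /= !wr_presE.
rewrite [wr_eval _]mulg1 [wr_eval _]mulg1 wr_nform => -[sum0 ->].
rewrite /nform mulg1 (prod_sconj_eq1 ps_comm ps_expg) // => a0.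
(* The coefficient at [- a0] is the number of occurrences of [a0] in [l], modulo [n]. *)
have /(congr1 (mcoeff (- a0)%R)) := sum0.
rewrite mcoeff0 raddf_sum /=.
have -> : (\sum_(k <- l) << 1 *g (- k) >>@_(- a0) = (count_mem a0 l)%:R :> 'Z_n)%R.
  elim: l {sum0} => [|k l IH]; first by rewrite big_nil.
  rewrite big_cons IH /= natrD mcoeffU; congr (_ + _)%R.
  by rewrite (inj_eq oppr_inj).
move/(congr1 val); rewrite /= val_Zp_nat // => h; exact/eqP.
Qed.

Lemma wr_pres_surj (g : W) : exists a, wr_pres a = g.
Proof.
have im_nform l m : exists a, wr_pres a = nform wr_s wr_t l m.
  exists (nform ps pt l m); rewrite gmulf_nform /= !wr_presE.
  by rewrite [wr_eval _]mulg1 [wr_eval _]mulg1.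
case: g => f m.
(* Each [- k] is repeated as often as the representative of [f@_k] below [n]; the sign cancels the
   one in [wr_nform]. *)
pose l := flatten [seq nseq (f@_k : 'Z_n) (- k)%R | k <- msupp f].
suff -> : (f, m) = nform wr_s wr_t l m by [].
rewrite wr_nform big_flatten big_map /= {1}[f]monalgE; congr pair.
apply: eq_bigr => k _; rewrite big_nseq iter_addr_0 opprK -monalgUMn.
by rewrite natr_Zp.
Qed.

Lemma wreath_presentation : presentation_of (lamplighter_rels n) W.
Proof.
exists wr_pres; rewrite -setTT_bijective.
split=> //; first by move=> a b _ _; apply: wr_pres_inj.
by move=> g _; have [a <-] := wr_pres_surj g; exists a.
Qed.

End Wreath.

Theorem proposition2 (n : nat) (hn : (2 <= n)%N) :
  presentation_of (lamplighter_rels n) (wreath_int 'Z_n) /\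
  minimal_presentation (lamplighter_rels n).
Proof.
split; first exact: wreath_presentation.
move=> r [->|[i i_gt0 <-]]; first exact/sX_not_redundant/ltnW.
exact: commg_not_redundant.
Qed.
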